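(* Let $X$ and $Y$ be finite nonempty sets. If $\Delta_{\mathcal R}\colon\mathcal P(\mathcal P(X))^n\to\mathcal P(\mathcal P(Y))$ is a local and separating Kripke-operator, then it weakly preserves supported convexity.
   Context: A family of sets $\mathcal A$ is convex if $S,T\in\mathcal A$ and $S\subseteq C\subseteq T$ imply $C\in\mathcal A$; it is supported if it is nonempty and $\bigcap\mathcal A\in\mathcal A$. For a relation $\mathcal R\subseteq\mathcal P(Y)\times\mathcal P(X)^n$ ($n$ a positive integer), the Kripke-operator $\Delta_{\mathcal R}\colon\mathcal P(\mathcal P(X))^n\to\mathcal P(\mathcal P(Y))$ is defined by: $B\in\Delta_{\mathcal R}(\mathcal A_0,\ldots,\mathcal A_{n-1})$ iff there are $A_0\in\mathcal A_0,\ldots,A_{n-1}\in\mathcal A_{n-1}$ with $(B,A_0,\ldots,A_{n-1})\in\mathcal R$. Write $\mathcal R[A]=\{(A_0,\ldots,A_{n-1}):(A,A_0,\ldots,A_{n-1})\in\mathcal R\}$. $\Delta_{\mathcal R}$ is local if for every $A\in\mathcal P(Y)$: $(A_0,\ldots,A_{n-1})\in\mathcal R[A]$ iff for each $a\in A$ there is $(A_0^a,\ldots,A_{n-1}^a)\in\mathcal R[\{a\}]$ such that $A_i=\bigcup_{a\in A}A_i^a$ for all $i<n$. $\Delta_{\mathcal R}$ is separating if $A_i\cap B_i=\emptyset$ for all $i<n$ whenever $(A_0,\ldots,A_{n-1})\in\mathcal R[\{a\}]$, $(B_0,\ldots,B_{n-1})\in\mathcal R[\{b\}]$ and $a\neq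 b$. $\Delta$ weakly preserves supported convexity if, whenever every $\mathcal A_i$ ($i<n$) is supported and convex, $\Delta(\mathcal A_0,\ldots,\mathcal A_{n-1})$ is either supported and convex, or empty. *)

(* Defs.v *)
From mathcomp Require Import all_boot.
Set Implicit Arguments.
Unset Strict Implicit.
Unset Printing Implicit Defensive.

Section Families.

Variable T : finType.
Implicit Types (F : {set {set T}}) (A B C : {set T}).

Definition convex_family F : Prop :=
  forall A B C, A \in F -> B \in F -> A \subset C -> C \subset B -> C \in F.

Definition supported_family F : Prop :=
  F <> set0 /\ (\bigcap_(A in F) A) \in F.

End Families.

Section Kripke.

Variables (X Y : finType) (n : nat).

(* An n-tuple (A_0, ..., A_{n-1}) of subsets of X is a finite function on 'I_n,
   and a relation between P(Y) and P(X)^n is the set of its related pairs. *)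
Definition kripke_relation : Type :=
  {set {set Y} * {ffun 'I_n -> {set X}}}.

Definition family_operator : Type :=
  {ffun 'I_n -> {set {set X}}} -> {set {set Y}}.

Implicit Type R : kripke_relation.

Definition kripke_operator R : family_operator := fun F =>
  [set B : {set Y} | [exists A : {ffun 'I_n -> {set X}},
                        [forall i, A i \in F i] && ((B, A) \in R)]].

Definition rel_image R (B : {set Y}) : {set {ffun 'I_n -> {set X}}} :=
  [set A : {ffun 'I_n -> {set X}} | (B, A) \in R].

(* Locality and separation of the operator are conditions on the relation R
   that presents it. In [kripke_local], G a is the tuple chosen for a; its
   values outside B are irrelevant. *)
Definition kripke_local R : Prop :=
  forall (B : {set Y}) (A : {ffun 'I_n -> {set X}}),
    A \in rel_image R B <->
    exists G : Y -> {ffun 'I_n -> {set X}},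
      (forall b, b \in B -> G b \in rel_image R [set b]) /\
      (forall i : 'I_n, A i = \bigcup_(b in B) G b i).

Definition kripke_separating R : Prop :=
  forall (a b : Y) (A B : {ffun 'I_n -> {set X}}),
    A \in rel_image R [set a] -> B \in rel_image R [set b] -> a <> b ->
    forall i : 'I_n, A i :&: B i = set0.

Definition weakly_preserves_supported_convexity (D : family_operator) : Prop :=
  forall F : {ffun 'I_n -> {set {set X}}},
    (forall i : 'I_n, supported_family (F i) /\ convex_family (F i)) ->
    (supported_family (D F) /\ convex_family (D F)) \/ D F = set0.

End Kripke.

(* Main.v *)
Require Import Defs.
From mathcomp Require Import all_boot.

(** Let [S i] be the least member of the supported family [F i], and let [B1],
    [B2] belong to [D], the image of [F] under the operator.  By locality, each
    [Bk] is witnessed by a tuple assembled from pieces [Gk b], [b \in Bk].  An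
    element of [S i] lies both in some [G1 b i] and in some [G2 b' i], and
    separation forces [b = b'].  Hence [S i] is already covered by the pieces
    [G2 b] with [b] in [B1 :&: B2].  So for every [C] between [B1 :&: B2] and
    [B2], the tuple assembled from the [G2 b] with [b \in C] is, at index [i],
    between [S i] and a member of [F i]; by convexity and locality [C \in D].
    This is [kripke_operator_interval].  The case [B1 \subset B2] is the
    convexity of [D]; the case [C = B1 :&: B2] says that [D] is closed under
    binary intersections, so that [D], being finite, is supported unless it is
    empty. *)

Lemma supported_family_setI (T : finType) (F : {set {set T}}) :
    F != set0 -> {in F &, forall A B, A :&: B \in F} ->
  supported_family F.
Proof.
move=> F_neq0 FI; split; first exact/eqP.
have [B0 FB0] := set0Pn _ F_neq0.
(* The empty intersection is [setT], which need not belong to [F]; prefixing a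
   fixed member [B0] makes the induction on the intersection start in [F]. *)
have: B0 :&: \bigcap_(A in F) A \in F.
  elim/big_rec: _ => [|A B FA FB]; first by rewrite setIT.
  by rewrite setICA; apply: FI.
by rewrite (setIidPr (bigcap_inf _ FB0)).
Qed.

Lemma kripke_operatorP (X Y : finType) (n : nat) (R : kripke_relation X Y n)
    (F : {ffun 'I_n -> {set {set X}}}) (B : {set Y}) :
  reflect (exists2 A : {ffun 'I_n -> {set X}},
             forall i, A i \in F i & A \in rel_image R B)
          (B \in kripke_operator R F).
Proof.
rewrite inE; apply: (iffP existsP) => [[A /andP[/forallP FA RA]] | [A FA RA]].
  by exists A; rewrite ?inE.
by exists A; apply/andP; split; [apply/forallP | move: RA; rewrite inE].
Qed.

Lemma kripke_operator_interval (X Y : finType) (n : nat)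
    (R : kripke_relation X Y n) (F : {ffun 'I_n -> {set {set X}}})
    (B1 B2 C : {set Y}) :
    kripke_local R -> kripke_separating R ->
    (forall i, supported_family (F i) /\ convex_family (F i)) ->
    B1 \in kripke_operator R F -> B2 \in kripke_operator R F ->
    B1 :&: B2 \subset C -> C \subset B2 ->
  C \in kripke_operator R F.
Proof.
move=> locR sepR suppF /kripke_operatorP[A1 FA1 /locR[G1 [RG1 defA1]]].
move=> /kripke_operatorP[A2 FA2 /locR[G2 [RG2 defA2]]] sIC sCB2.
apply/kripke_operatorP; exists [ffun i => \bigcup_(b in C) G2 b i]; last first.
  apply/locR; exists G2; split=> [b Cb | i]; last by rewrite ffunE.
  exact/RG2/(subsetP sCB2).
move=> i; rewrite ffunE; have [[_ FS] convF] := suppF i.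
apply: convF FS (FA2 i) _ _; last first.
  rewrite defA2; apply/bigcupsP=> b Cb.
  by apply: (bigcup_sup b); apply: (subsetP sCB2).
apply/subsetP=> x /bigcapP Sx.
have:= Sx _ (FA1 i); rewrite defA1 => /bigcupP[b B1b G1x].
have:= Sx _ (FA2 i); rewrite defA2 => /bigcupP[b' B2b' G2x].
have [eq_b | /eqP neq_b] := eqVneq b b'; last first.
  have /setP/(_ x) := sepR _ _ _ _ (RG1 b B1b) (RG2 b' B2b') neq_b i.
  by rewrite !inE G1x G2x.
by apply/bigcupP; exists b' => //; apply: (subsetP sIC); rewrite inE -{1}eq_b B1b.
Qed.

Theorem theorem4p19 (X Y : finType) (n : nat) (R : kripke_relation X Y n)
    (hX : 0 < #|X|) (hY : 0 < #|Y|) (hn : 0 < n)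
    (hloc : kripke_local R) (hsep : kripke_separating R) :
  weakly_preserves_supported_convexity (kripke_operator R).
Proof.
move=> F suppF.
have [-> | D_neq0] := eqVneq (kripke_operator R F) set0; first by right.
left; split.
  apply: supported_family_setI => // B1 B2 DB1 DB2.
  apply: kripke_operator_interval DB1 DB2 _ _ => //; exact: subsetIr.
move=> B1 B2 C DB1 DB2 sB1C sCB2.
apply: kripke_operator_interval DB1 DB2 _ sCB2 => //.
exact: subset_trans (subsetIl _ _) sB1C.
Qed.
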